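(* For every natural number $N\ge 1$, the spectral map $\Omega: Z_N\to Z_N$, $(a,A)\mapsto(b,B)$, is an involution on $Z_N$, i.e. $\Omega(\Omega(a,A))=(a,A)$ for all $(a,A)\in Z_N$. In particular, $\Omega$ is a bijection on $Z_N$.
   Context: Let $N\ge 1$ be a natural number. $Z_N$ denotes the set of all pairs $(a,A)$ where $a=(a_1,\dots,a_N)$ consists of distinct positive real numbers listed in increasing order, $0<a_1<a_2<\dots<a_N$, and $A=(A_1,\dots,A_N)$ consists of positive real numbers (in no particular order, not necessarily distinct). For $(a,A)\in Z_N$, the weighted Cauchy matrix is the $N\times N$ matrix $$\mathcal{C}_{a,A}=\left\{\frac{\sqrt{A_jA_k}}{a_k+a_j}\right\}_{j,k=1}^N,$$ and $v_A=(\sqrt{A_1},\dots,\sqrt{A_N})\in\mathbb{C}^N$. The matrix $\mathcal{C}_{a,A}$ is positive definite and $v_A$ is a cyclic vector for it (the vectors $\mathcal{C}_{a,A}^n v_A$, $n\ge 0$, span $\mathbb{C}^N$), so $\mathcal{C}_{a,A}$ has $N$ distinct positive eigenvalues. The spectral map $\Omega:Z_N\to Z_N$ is defined by $\Omega(a,A)=(b,B)$, where $b=(b_1,\dots,b_N)$ are the eigenvalues of $\mathcal{C}_{a,A}$ listed in increasing order, and $B=(B_1,\dots,B_N)$ with $B_k=|\langle v_A,f_k\rangle|^2$, where $f_k$ is an eigenvector of $\mathcal{C}_{a,A}$ for the eigenvalue $b_k$, normalised to have Euclidean norm $1$, and $\langle\cdot,\cdot\rangle$ is the standard Euclidean inner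 product on $\mathbb{C}^N$. ($B_k$ does not depend on the choice of $f_k$, and $B_k>0$.) *)

(* Defs.v *)
From HB Require Import structures.
From mathcomp Require Import all_boot all_order all_algebra.
From mathcomp Require Import boolp classical_sets functions reals.
From mathcomp.real_closed Require Import complex.

Set Implicit Arguments.
Unset Strict Implicit.
Unset Printing Implicit Defensive.

Import Order.TTheory GRing.Theory Num.Theory.

Local Open Scope classical_set_scope.
Local Open Scope ring_scope.
Local Open Scope complex_scope.

Definition increasing (R : realType) (N : nat) (a : 'rV[R]_N) : Prop :=
  forall i j : 'I_N, (i < j)%N -> a 0 i < a 0 j.

Definition ZN (R : realType) (N : nat) : set ('rV[R]_N * 'rV[R]_N) :=
  [set p : 'rV[R]_N * 'rV[R]_N |
    [/\ increasing p.1,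
        forall i : 'I_N, 0 < p.1 0 i &
        forall i : 'I_N, 0 < p.2 0 i]].
Arguments ZN : clear implicits.

Definition cauchy_mx (R : realType) (N : nat) (a A : 'rV[R]_N) : 'M[R[i]]_N :=
  \matrix_(j, k) (Num.sqrt (A 0 j * A 0 k) / (a 0 k + a 0 j))%:C.

Definition weight_vec (R : realType) (N : nat) (A : 'rV[R]_N) : 'rV[R[i]]_N :=
  \row_j (Num.sqrt (A 0 j))%:C.

(* Vectors of C^N are rows, and [eigenvalue] and [eigenspace] refer to the
   action v |-> v *m M; since [cauchy_mx a A] is symmetric, this agrees with
   the action on columns. *)
Lemma trmx_cauchy_mx (R : realType) (N : nat) (a A : 'rV[R]_N) :
  (cauchy_mx a A)^T = cauchy_mx a A.
Proof.
by apply/matrixP => j k; rewrite !mxE [A 0 k * _]mulrC [a 0 j + _]addrC.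
Qed.

Definition unit_eigenvector (R : realType) (N : nat) (M : 'M[R[i]]_N)
    (z : R[i]) (f : 'rV[R[i]]_N) : Prop :=
  (f <= eigenspace M z)%MS /\ sqrtC (dotmx f f) = 1.

Definition spectral_data (R : realType) (N : nat)
    (p q : 'rV[R]_N * 'rV[R]_N) : Prop :=
  let C := cauchy_mx p.1 p.2 in
  let v := weight_vec p.2 in
  [/\ increasing q.1,
      forall z : R[i], eigenvalue C z <-> exists k, z = (q.1 0 k)%:C &
      forall k, exists f, unit_eigenvector C (q.1 0 k)%:C f /\
                          (q.2 0 k)%:C = `|dotmx v f| ^+ 2].

(* On [ZN R N] the pair [q] exists and is unique, so the default value
   is not used; for 0 < N the default (0, 0) lies outside
   [ZN R N]. *)
Definition Omega (R : realType) (N : nat) (p : 'rV[R]_N * 'rV[R]_N) :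
    'rV[R]_N * 'rV[R]_N :=
  xget (0, 0) [set q | spectral_data p q].

(* Main.v *)
(* With D = diag(a) and v = v_A, the matrix C = C_{a,A} is the unique solution of
   the Lyapunov equation D C + C D = v^T v. If a unitary U diagonalizes C,
   U C U^* = diag(b), with phases chosen so that v U^* is positive, then
   v U^* = v_B, and conjugating the equation by U shows that U D U^* solves the
   Lyapunov equation of (b, B), so that U D U^* = C_{b,B}. Hence U^* diagonalizes
   C_{b,B} with eigenvalues a, and v_B U = v_A. That (b, B) lies in Z_N
   follows from the fact that no eigenvector of C is orthogonal to v. *)
Require Import Defs.
From mathcomp Require Import all_boot all_order all_algebra.
From mathcomp Require Import boolp classical_sets functions reals.
From mathcomp Require Import all_fingroup.
From mathcomp.real_closed Require Import complex.

Set Implicit Arguments.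
Unset Strict Implicit.
Unset Printing Implicit Defensive.

Import Order.TTheory GRing.Theory Num.Theory.

Local Open Scope ring_scope.
Local Open Scope complex_scope.
Local Open Scope sesquilinear_scope.

(** * Adjoints, inner products and phases *)

Lemma trmxC_mul (C : numClosedFieldType) m n p (A : 'M[C]_(m, n))
    (B : 'M[C]_(n, p)) : (A *m B)^t* = B^t* *m A^t*.
Proof. by rewrite trmx_mul map_mxM. Qed.

Lemma dotmxZl (C : numClosedFieldType) n (c : C) (u v : 'rV[C]_n) :
  dotmx (c *: u) v = c * dotmx u v.
Proof. by rewrite !dotmxE -scalemxAl mxE. Qed.

Lemma dotmxZr (C : numClosedFieldType) n (c : C) (u v : 'rV[C]_n) :
  dotmx u (c *: v) = Num.conj c * dotmx u v.
Proof. by rewrite !dotmxE linearZ map_mxZ -scalemxAr mxE. Qed.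

Lemma dotmxBl (C : numClosedFieldType) n (u v w : 'rV[C]_n) :
  dotmx (u - v) w = dotmx u w - dotmx v w.
Proof. by rewrite !dotmxE mulmxBl !mxE. Qed.

Lemma dotmxBr (C : numClosedFieldType) n (u v w : 'rV[C]_n) :
  dotmx u (v - w) = dotmx u v - dotmx u w.
Proof. by rewrite !dotmxE linearB map_mxB mulmxBr !mxE. Qed.

(** The combination [h] of [f] and [g] is orthogonal to [v] by its choice of coefficients, hence
    zero. Pairing it with [g] leaves a nonzero multiple of [dotmx g g]. *)
Lemma eigenspace_line (C : numClosedFieldType) n (M : 'M[C]_n) z
    (v f g : 'rV[C]_n) :
  f *m M = z *: f -> g *m M = z *: g -> dotmx f g = 0 -> dotmx v f != 0 ->
  (forall h, h *m M = z *: h -> dotmx v h = 0 -> h = 0) -> g = 0.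
Proof.
move=> fM gM fg vf0 orth0.
pose h := Num.conj (dotmx v g) *: f - Num.conj (dotmx v f) *: g.
have h0 : h = 0.
  apply: orth0.
    by rewrite mulmxBl -!scalemxAl fM gM scalerBr !scalerA ![_ * z]mulrC.
  by rewrite dotmxBr !dotmxZr !conjCK mulrC subrr.
have /eqP : dotmx h g = 0 by rewrite h0 dotmxE mul0mx mxE.
rewrite dotmxBl !dotmxZl fg mulr0 sub0r oppr_eq0 mulf_eq0.
rewrite conjC_eq0 (negbTE vf0) /=.
by rewrite (dnorm_eq0 (@dotmx C n)) => /eqP.
Qed.

Lemma norm_phase (C : numClosedFieldType) (w : C) :
  w != 0 -> `|w / `|w| | ^+ 2 = 1.
Proof. by move=> w0; rewrite normf_div normr_id divff ?normr_eq0 ?expr1n. Qed.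

Lemma conj_phase_mul (C : numClosedFieldType) (w : C) :
  w != 0 -> Num.conj (w / `|w|) * w = `|w|.
Proof.
move=> w0; rewrite rmorphM fmorphV /= (conj_Creal (normr_real _)).
by rewrite mulrC mulrA -normCK expr2 mulfK // normr_eq0.
Qed.

(** * The Lyapunov equation *)

Section Lyapunov.
Variables (R : realType) (N : nat).
Implicit Types (a A : 'rV[R]_N) (f : 'rV[R[i]]_N) (p q : 'rV[R]_N * 'rV[R]_N).

Definition node_mx a : 'M[R[i]]_N := diag_mx (map_mx (real_complex R) a).

Lemma conjC_real_complex (x : R) : Num.conj x%:C = x%:C.
Proof. by apply: conj_Creal; apply/complex_realP; exists x. Qed.

Lemma trmxC_node_mx a : (node_mx a)^t* = node_mx a.
Proof.
rewrite tr_diag_mx map_diag_mx; congr diag_mx.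
by apply/rowP => j; rewrite !mxE /= conjC_real_complex.
Qed.

Lemma trmxC_cauchy_mx a A : (cauchy_mx a A)^t* = cauchy_mx a A.
Proof.
rewrite trmx_cauchy_mx; apply/matrixP => j k.
by rewrite !mxE /= conjC_real_complex.
Qed.

Lemma trmxC_weight_vec A : (weight_vec A)^t* = (weight_vec A)^T.
Proof. by apply/colP => j; rewrite !mxE /= conjC_real_complex. Qed.

Lemma cauchy_mx_lyapunov a A :
  (forall j, 0 < a 0 j) -> (forall j, 0 < A 0 j) ->
  node_mx a *m cauchy_mx a A + cauchy_mx a A *m node_mx a
    = (weight_vec A)^T *m weight_vec A.
Proof.
move=> a_gt0 A_gt0; apply/matrixP => j k.
rewrite mul_diag_mx mul_mx_diag !mxE big_ord1 !mxE.
rewrite [X in _ + X]mulrC -mulrDl -!rmorphD -!rmorphM /= sqrtrM ?ltW //.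
have nz : a 0 k + a 0 j != 0 by rewrite gt_eqF ?addr_gt0.
by rewrite [a 0 j + _]addrC mulrC divfK.
Qed.

(** The Lyapunov operator multiplies entry [(j, k)] by [a_j + a_k], which is positive. *)
Lemma lyapunov_inj a (X Y : 'M[R[i]]_N) : (forall j, 0 < a 0 j) ->
  node_mx a *m X + X *m node_mx a = node_mx a *m Y + Y *m node_mx a -> X = Y.
Proof.
move=> a_gt0 /matrixP eqXY; apply/matrixP => j k; have := eqXY j k.
rewrite !mul_diag_mx !mul_mx_diag !mxE.
rewrite ![_ * (a 0 k)%:C]mulrC -!mulrDl -rmorphD /=.
apply: mulfI; rewrite (_ : 0 = 0%:C) // (inj_eq (@complexI R)).
by rewrite gt_eqF ?addr_gt0.
Qed.

(** The form is the sum of the [a_k |f_k|^2], and some [f_j] is nonzero. *)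
Lemma node_form_gt0 a f : (forall j, 0 < a 0 j) -> f != 0 ->
  0 < dotmx (f *m node_mx a) f.
Proof.
move=> a_gt0 /rV0Pn [j fj]; rewrite dotmxE mul_mx_diag mxE (bigD1 j) //=.
have E k : (\matrix_(i, l) (f i l * (map_mx (real_complex R) a) 0 l)) 0 k
    * (f^t*) k 0 = (a 0 k)%:C * `|f 0 k| ^+ 2.
  by rewrite normCK !mxE mulrAC mulrC.
rewrite E; apply: ltr_pwDl.
  by rewrite mulr_gt0 ?exprn_gt0 ?normr_gt0 // (ltcR 0).
by apply: sumr_ge0 => k _; rewrite E mulr_ge0 ?exprn_ge0 // (lecR 0) ltW.
Qed.

(** * Eigenvectors of the Cauchy matrix and the weight vector *)

(** Sandwich the Lyapunov equation between [f] and its adjoint: as [C] is Hermitian and [z] real,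
    both terms on the left give [z] times the same form. *)
Lemma cauchy_eigenvector_form p z f : ZN R N p -> z \is Num.real ->
  f *m cauchy_mx p.1 p.2 = z *: f ->
  z *+ 2 * dotmx (f *m node_mx p.1) f = `|dotmx (weight_vec p.2) f| ^+ 2.
Proof.
case=> _ a_gt0 A_gt0 zR fC.
have /(congr1 (fun M => (f *m M *m f^t*) 0 0)) := cauchy_mx_lyapunov a_gt0 A_gt0.
rewrite mulmxDr mulmxDl !mulmxA fC.
rewrite -(mulmxA _ (cauchy_mx _ _)) -{1}trmxC_cauchy_mx -trmxC_mul fC.
rewrite linearZ map_mxZ /= conj_Creal // -scalemxAr -!scalemxAl.
rewrite mxE [in LHS]mxE -dotmxE -mulrDl -mulr2n => ->.
rewrite -trmxC_weight_vec -{1}(trmxCK f) -trmxC_mul -mulmxA mxE big_ord1.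
by rewrite !mxE normCK dotmxE mxE mulrC.
Qed.

(* The form above makes [v] orthogonal to the kernel of [C], and then the
   Lyapunov equation makes the kernel stable under [node_mx a]; as the [a_i] are
   distinct, interpolation isolates each coordinate. *)
Lemma cauchy_ker0 p f : ZN R N p -> f *m cauchy_mx p.1 p.2 = 0 -> f = 0.
Proof.
move=> Zp; have [a_inc a_gt0 A_gt0] := Zp.
have orth (g : 'rV[R[i]]_N) :
    g *m cauchy_mx p.1 p.2 = 0 -> g *m (weight_vec p.2)^T = 0.
  move=> gC; have := @cauchy_eigenvector_form p 0 g Zp (real0 _).
  rewrite scale0r mul0rn mul0r => /(_ gC) /esym /eqP.
  rewrite expf_eq0 /= normr_eq0 dotmxE => /eqP E.
  rewrite -trmxC_weight_vec -{1}(trmxCK g) -trmxC_mul.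
  suff -> : weight_vec p.2 *m g^t* = 0 by rewrite trmx0 map_mx0.
  by apply/matrixP => i j; rewrite !ord1 E mxE.
have stab (g : 'rV[R[i]]_N) : g *m cauchy_mx p.1 p.2 = 0 ->
    (g *m node_mx p.1) *m cauchy_mx p.1 p.2 = 0.
  move=> gC; have := congr1 (mulmx g) (cauchy_mx_lyapunov a_gt0 A_gt0).
  by rewrite mulmxDr !mulmxA gC mul0mx addr0 orth // mul0mx.
move=> fC; apply/rowP => j; rewrite [RHS]mxE.
have interp (s : seq 'I_N) :
    (\row_k (f 0 k * \prod_(i <- s) (p.1 0 k - p.1 0 i)%:C))
      *m cauchy_mx p.1 p.2 = 0.
  elim: s => [|i s IH].
    rewrite (_ : \row_k _ = f) //; apply/rowP => k.
    by rewrite mxE big_nil mulr1.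
  set g := \row__ _ in IH.
  rewrite (_ : \row_k _ = g *m node_mx p.1 - (p.1 0 i)%:C *: g).
    by rewrite mulmxBl stab // -scalemxAl IH scaler0 subr0.
  apply/rowP => k; rewrite mul_mx_diag !mxE big_cons rmorphB.
  by rewrite mulrCA mulrBl [_ * (p.1 0 k)%:C]mulrC.
have := orth _ (interp [seq i <- enum 'I_N | i != j]).
move/matrixP/(_ 0 0); rewrite !mxE (bigD1 j) //= big1 => [|k kj]; last first.
  rewrite !mxE (big_rem k) /=; last by rewrite mem_filter kj mem_enum.
  by rewrite subrr rmorph0 mul0r mulr0 mul0r.
move/eqP; rewrite addr0 !mxE mulf_eq0 mulf_eq0 -orbA => /or3P[/eqP //||].
  rewrite big_filter prodf_seq_eq0 => /hasP [i _ /andP[ij]].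
  rewrite (_ : 0 = 0%:C) // (inj_eq (@complexI R)) subr_eq0 => /eqP aij.
  by case: (ltngtP i j) ij => [/a_inc|/a_inc|/val_inj ->]; rewrite ?aij ?ltxx ?eqxx.
rewrite (_ : 0 = 0%:C) // (inj_eq (@complexI R)).
by rewrite gt_eqF // sqrtr_gt0.
Qed.

Lemma cauchy_eigenvector_orth0 p z f : ZN R N p -> z \is Num.real ->
  f *m cauchy_mx p.1 p.2 = z *: f -> dotmx (weight_vec p.2) f = 0 -> f = 0.
Proof.
move=> Zp zR fC vf; have [_ a_gt0 _] := Zp.
have := cauchy_eigenvector_form Zp zR fC.
rewrite vf normr0 expr0n /= => /eqP; rewrite mulf_eq0 mulrn_eq0 /= => /orP[].
  by move=> /eqP z0; apply: (cauchy_ker0 Zp); rewrite fC z0 scale0r.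
by apply: contraTeq => f0; rewrite gt_eqF ?node_form_gt0.
Qed.

(** Gives the simplicity of the spectrum: an orthonormal eigenbasis cannot repeat an eigenvalue. *)
Lemma cauchy_eigenspace_line p z f g : ZN R N p -> z \is Num.real -> f != 0 ->
  f *m cauchy_mx p.1 p.2 = z *: f -> g *m cauchy_mx p.1 p.2 = z *: g ->
  dotmx f g = 0 -> g = 0.
Proof.
move=> Zp zR f0 fC gC fg; set v := weight_vec p.2.
have vf0 : dotmx v f != 0.
  by apply: contra_neq f0; apply: cauchy_eigenvector_orth0 fC.
apply: (eigenspace_line fC gC fg vf0) => h.
exact: cauchy_eigenvector_orth0.
Qed.

Lemma cauchy_eigenvalue_gt0 p z f : ZN R N p -> z \is Num.real -> f != 0 ->
  f *m cauchy_mx p.1 p.2 = z *: f -> 0 < z.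
Proof.
move=> Zp zR f0 fC; have [_ a_gt0 _] := Zp.
have vf0 : dotmx (weight_vec p.2) f != 0.
  by apply: contra_neq f0; apply: cauchy_eigenvector_orth0 fC.
rewrite -(pmulrn_lgt0 _ (isT : 0 < 2)%N) -(pmulr_lgt0 _ (node_form_gt0 a_gt0 f0)).
by rewrite (cauchy_eigenvector_form Zp zR fC) exprn_gt0 ?normr_gt0.
Qed.

(** * Unitary diagonalization and its symmetry *)

(** The rows of [U] are an orthonormal eigenbasis, and the last condition fixes their phases. Unlike
    [spectral_data], this relation is easily reversed. *)
Definition diagonalized_by (U : 'M[R[i]]_N) p q : Prop :=
  [/\ U \is unitarymx,
      U *m cauchy_mx p.1 p.2 = node_mx q.1 *m U &
      weight_vec p.2 *m U^t* = weight_vec q.2].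

Lemma diagonalized_by_adj U p q : diagonalized_by U p q ->
  cauchy_mx p.1 p.2 *m U^t* = U^t* *m node_mx q.1.
Proof.
case=> _ UC _.
by rewrite -{1}trmxC_cauchy_mx -trmxC_mul UC trmxC_mul trmxC_node_mx.
Qed.

Lemma diagonalized_by_sym U p q : ZN R N p -> ZN R N q ->
  diagonalized_by U p q -> diagonalized_by (U^t*) q p.
Proof.
move=> [_ a_gt0 A_gt0] [_ b_gt0 B_gt0] dU; have [Uu UC Uv] := dU.
have UVu : U^t* *m U = 1%:M by rewrite -[LHS]mul1mx mulmxA mulmxKtV.
split; first by rewrite trmxC_unitary.
  suff -> : cauchy_mx q.1 q.2 = U *m node_mx p.1 *m U^t*.
    by rewrite !mulmxA UVu mul1mx.
  apply: (lyapunov_inj b_gt0); rewrite cauchy_mx_lyapunov //.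
  rewrite -trmxC_weight_vec -Uv trmxC_mul trmxCK trmxC_weight_vec.
  rewrite [LHS]mulmxA -[in LHS](mulmxA U) -(cauchy_mx_lyapunov a_gt0) //.
  have CU := diagonalized_by_adj dU.
  (* Moving [C] out past [U] or [U^*] turns it into [node_mx q.1] on the opposite side of [U D U^*],
     so the two summands trade places. *)
  by rewrite mulmxDr mulmxDl !mulmxA UC -!mulmxA CU !mulmxA addrC.
by rewrite -Uv trmxCK -mulmxA UVu mulmx1.
Qed.

Lemma diagonalized_by_row U p q k : diagonalized_by U p q ->
  row k U *m cauchy_mx p.1 p.2 = (q.1 0 k)%:C *: row k U.
Proof.
case=> _ UC _; rewrite -row_mul UC.
by apply/rowP => j; rewrite mul_diag_mx !mxE.
Qed.

Lemma diagonalized_by_weight U p q k : diagonalized_by U p q ->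
  dotmx (weight_vec p.2) (row k U) = (Num.sqrt (q.2 0 k))%:C.
Proof.
case=> _ _ /rowP /(_ k); rewrite [RHS]mxE => <-.
by rewrite dotmxE !mxE; apply: eq_bigr => j _; rewrite !mxE.
Qed.

(** The entries of [f *m U^t*] are the coordinates of [f] in the eigenbasis; a nonzero one forces
    [z] to be the matching eigenvalue. *)
Lemma diagonalized_by_coord U p q z f k : diagonalized_by U p q ->
  f *m cauchy_mx p.1 p.2 = z *: f ->
  (f *m U^t*) 0 k * (q.1 0 k)%:C = z * (f *m U^t*) 0 k.
Proof.
move=> dU fC.
have /rowP/(_ k) : f *m U^t* *m node_mx q.1 = z *: (f *m U^t*).
  by rewrite -mulmxA -(diagonalized_by_adj dU) mulmxA fC scalemxAl.
by rewrite mul_mx_diag [LHS]mxE [RHS]mxE [X in _ * X = _ -> _]mxE.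
Qed.

(** * Existence and uniqueness of the spectral data *)

Lemma diagonalized_by_spectral_data U p q : ZN R N q ->
  diagonalized_by U p q -> spectral_data p q.
Proof.
move=> [b_inc _ B_gt0] dU; have [Uu _ _] := dU.
have norm1 k : dotmx (row k U) (row k U) = 1.
  by have /row_unitarymxP -> := Uu; rewrite eqxx.
split=> // [z|k].
  split=> [/eigenvalueP [f fC f0]|[k ->]]; last first.
    apply/eigenvalueP; exists (row k U); first exact: diagonalized_by_row dU.
    by rewrite -(dnorm_eq0 (@dotmx R[i] N)) /= norm1 oner_eq0.
  have /rV0Pn [k fk] : f *m U^t* != 0.
    apply: contra_neq f0 => fU.
    by rewrite -(mulmxKtV f Uu) // fU mul0mx.
  exists k; apply: (mulIf fk).
  by rewrite -(diagonalized_by_coord k dU fC) mulrC.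
exists (row k U); split.
  split; last by rewrite norm1 sqrtC1.
  by apply/eigenspaceP; exact: diagonalized_by_row dU.
rewrite (diagonalized_by_weight k dU) ger0_norm; last by rewrite (lecR 0) sqrtr_ge0.
by rewrite -rmorphXn /= sqr_sqrtr // ltW.
Qed.

Lemma increasing_inj a : increasing a -> injective (a 0).
Proof.
move=> a_inc i j aij; case: (ltngtP i j) => [/a_inc|/a_inc|/val_inj //];
by rewrite aij ltxx.
Qed.

(** Strong induction on the index: if all earlier entries agree, the value [a 0 k] occurs in [b] at
    an index at least [k], so [b 0 k <= a 0 k], and symmetrically. *)
Lemma increasing_range_eq a b : increasing a -> increasing b ->
  (forall i, exists j, a 0 i = b 0 j) -> (forall i, exists j, b 0 i = a 0 j) ->
  a = b.
Proof.
move=> a_inc b_inc ab ba; apply/rowP => k.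
have [n] := ubnP (k : nat); elim: n k => // n IH k /ltnSE kn.
have le (c d : 'rV[R]_N) (l : 'I_N) : increasing c -> increasing d ->
    c 0 k = d 0 l -> (forall i : 'I_N, (i < k)%N -> c 0 i = d 0 i) ->
    d 0 k <= c 0 k.
  move=> c_inc d_inc cd cdi; case: (ltngtP l k) => [lk|kl|/val_inj lk].
  - by have := c_inc _ _ lk; rewrite cdi // cd ltxx.
  - by rewrite cd ltW // d_inc.
  - by rewrite cd lk.
have IHk (i : 'I_N) : (i < k)%N -> a 0 i = b 0 i.
  by move=> ik; apply: IH; apply: leq_trans kn.
have [l al] := ab k; have [m bm] := ba k.
apply/le_anti/andP; split; last exact: le al IHk.
by apply: le bm _ => // i /IHk.
Qed.

(** The nodes are the same spectrum listed in increasing order. For the weights, a unit eigenvector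
    is a unimodular multiple of a row of [U], and the squared modulus ignores that factor. *)
Lemma spectral_data_uniq U p q r : ZN R N q -> diagonalized_by U p q ->
  spectral_data p r -> r = q.
Proof.
move=> Zq dU [r_inc r_eig r_wt].
have [_ q_eig _] := diagonalized_by_spectral_data Zq dU.
have [q_inc _ B_gt0] := Zq; have [Uu _ _] := dU.
have eq1 : r.1 = q.1.
  apply: increasing_range_eq => // k.
    have /q_eig [l /complexI ->] : eigenvalue (cauchy_mx p.1 p.2) (r.1 0 k)%:C.
      by apply/r_eig; exists k.
    by exists l.
  have /r_eig [l /complexI ->] : eigenvalue (cauchy_mx p.1 p.2) (q.1 0 k)%:C.
    by apply/q_eig; exists k.
  by exists l.
suff eq2 : r.2 = q.2 by case: r q eq1 eq2 {r_inc r_eig r_wt q_eig Zq dU q_inc B_gt0}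
  => [? ?] [? ?] /= -> ->.
apply/rowP => k; have [f [[/eigenspaceP fC f1] fB]] := r_wt k.
(* All other coordinates of [f] vanish because the entries of [q.1] are distinct. *)
have fU : f = (f *m U^t*) 0 k *: row k U.
  rewrite -[LHS](mulmxKtV _ Uu) // mulmx_sum_row (bigD1 k) //= big1 ?addr0 // => j jk.
  have /eqP := diagonalized_by_coord j dU fC.
  rewrite mulrC -subr_eq0 -mulrBl mulf_eq0 eq1 -rmorphB => /orP[|/eqP -> //].
    rewrite (_ : 0 = 0%:C) // (inj_eq (@complexI R)) subr_eq0 => /eqP.
    by move/(increasing_inj q_inc)/eqP; rewrite (negbTE jk).
  by rewrite scale0r.
have c1 : `|(f *m U^t*) 0 k| ^+ 2 = 1.
  have norm1 : dotmx (row k U) (row k U) = 1.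
    by have /row_unitarymxP -> := Uu; rewrite eqxx.
  have /(congr1 (fun x => x ^+ 2)) := f1; rewrite sqrtCK expr1n {1 2}fU.
  by rewrite dnormZ /= norm1 mulr1.
apply: (@complexI R); rewrite fB fU dotmxZr normrM exprMn norm_conjC.
rewrite c1 mul1r (diagonalized_by_weight k dU).
rewrite ger0_norm; last by rewrite (lecR 0) sqrtr_ge0.
by rewrite -rmorphXn /= sqr_sqrtr // ltW.
Qed.

(** Sorting yields the permutation; injectivity excludes repetitions, so the order is strict. *)
Lemma sort_increasing (r : 'I_N -> R) : injective r ->
  exists s : 'S_N, increasing (\row_k r (s k)).
Proof.
move=> r_inj; pose t := [tuple r i | i < N].
have /tuple_permP [s es] : perm_eq (sort <=%O t) t by rewrite perm_sort.
exists s => i j ij; rewrite !mxE.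
have st : sorted <%O (sort <=%O t).
  by rewrite sort_lt_sorted map_inj_uniq // enum_uniq.
have e (k : 'I_N) : r (s k) = nth 0 (sort <=%O t) k.
  have -> : nth 0 (sort <=%O t) k = tnth [tuple tnth t (s i0) | i0 < N] k.
    by rewrite (tnth_nth 0) -es.
  by rewrite !tnth_mktuple.
by rewrite !e lt_sorted_ltn_nth // inE size_sort size_tuple.
Qed.

(** The spectral theorem supplies the orthonormal eigenbasis [P]; its rows only need to be sorted by
    eigenvalue and given the right phases. *)
Lemma diagonalized_by_exists p : ZN R N p ->
  exists q U, ZN R N q /\ diagonalized_by U p q.
Proof.
move=> Zp; set C := cauchy_mx p.1 p.2; set v := weight_vec p.2.
have C_herm : C \is hermsymmx.
  by apply/is_hermitianmxP; rewrite expr0 scale1r trmxC_cauchy_mx.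
pose P := spectralmx C; pose sp := spectral_diag C.
have Pu : P \is unitarymx := spectral_unitarymx C.
have spR k : sp 0 k \is Num.real.
  by have /mxOverP := hermitian_spectral_diag_real C_herm; apply.
have PC k : row k P *m C = sp 0 k *: row k P.
  rewrite {1}(orthomx_spectralP (hermitian_normalmx C_herm)) -/P -/sp -row_mul.
  rewrite !mulmxA mulmxV ?unitarymx_unit // mul1mx.
  by apply/rowP => j; rewrite mul_diag_mx !mxE.
have dotP i j : dotmx (row i P) (row j P) = (i == j)%:R.
  by have /row_unitarymxP := Pu.
have P0 k : row k P != 0.
  by rewrite -(dnorm_eq0 (@dotmx R[i] N)) /= dotP eqxx oner_eq0.
pose w k := dotmx v (row k P).
have w0 k : w k != 0.
  apply/eqP => wk; move: (P0 k).
  by rewrite (cauchy_eigenvector_orth0 Zp (spR k) (PC k) wk) eqxx.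
have spE k : sp 0 k = (complex.Re (sp 0 k))%:C by rewrite RRe_real.
have r_inj : injective (fun k => complex.Re (sp 0 k)).
  move=> i j /(congr1 (real_complex R)); rewrite -!spE => sij.
  apply/eqP; apply: contraT => ij.
  have orth : dotmx (row i P) (row j P) = 0 by rewrite dotP (negbTE ij).
  have PCj : row j P *m C = sp 0 i *: row j P by rewrite sij PC.
  have := P0 j.
  by rewrite (cauchy_eigenspace_line Zp (spR i) (P0 i) (PC i) PCj orth) eqxx.
have [s s_inc] := sort_increasing r_inj.
have wE k : `|w k| = (complex.Re `|w k|)%:C by rewrite RRe_real ?normr_real.
have w_gt0 k : 0 < complex.Re `|w k|.
  by rewrite -ltcR -wE normr_gt0.
(* Since [dotmx] is conjugate linear on the right, this phase turns the inner product [w (s k)] of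
   [v] with the row into its modulus. *)
pose U := \matrix_k ((w (s k) / `|w (s k)|) *: row (s k) P).
(* The weights are squared moduli, so that their square roots in [weight_vec] return the moduli. *)
exists (\row_k complex.Re (sp 0 (s k)), \row_k (complex.Re `|w (s k)|) ^+ 2), U.
split.
  split; first exact: s_inc.
    move=> k; rewrite mxE -ltcR -spE.
    exact: cauchy_eigenvalue_gt0 Zp (spR _) (P0 _) (PC _).
  by move=> k; rewrite mxE; apply: exprn_gt0; exact: w_gt0.
split.
- apply/row_unitarymxP => i j; rewrite !rowK dotmxZl dotmxZr dotP.
  rewrite (inj_eq perm_inj); case: eqP => [->|_]; last by rewrite !mulr0.
  by rewrite mulr1 -normCK norm_phase.
- apply/row_matrixP => k; rewrite row_mul rowK -scalemxAl PC.
  by apply/rowP => j; rewrite mul_diag_mx !mxE spE mulrCA.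
- apply/rowP => k; transitivity (dotmx v (row k U)).
    by rewrite dotmxE !mxE; apply: eq_bigr => j _; rewrite !mxE.
  rewrite rowK dotmxZr -/(w _) conj_phase_mul // [RHS]mxE.
  have -> : Num.sqrt ((\row_l complex.Re `|w (s l)| ^+ 2) 0 k) =
      complex.Re `|w (s k)|.
    by rewrite mxE sqrtr_sqr gtr0_norm // w_gt0.
  exact: wE.
Qed.

(** * The spectral map as an involution *)

(** Replaces the choice made by [xget] with any diagonalization, by existence and uniqueness of the
    spectral data. *)
Lemma Omega_diagonalized p q U : ZN R N q -> diagonalized_by U p q ->
  Omega p = q.
Proof.
move=> Zq dU; apply: xget_unique; first exact: diagonalized_by_spectral_data dU.
by move=> r; exact: spectral_data_uniq dU.
Qed.

Lemma Omega_ZN p : ZN R N p -> ZN R N (Omega p).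
Proof.
move=> /diagonalized_by_exists [q [U [Zq dU]]].
by rewrite (Omega_diagonalized Zq dU).
Qed.

Lemma OmegaK p : ZN R N p -> Omega (Omega p) = p.
Proof.
move=> Zp; have [q [U [Zq dU]]] := diagonalized_by_exists Zp.
rewrite (Omega_diagonalized Zq dU).
(* The adjoint of the same unitary leads from [q] back to [p]. *)
exact: Omega_diagonalized Zp (diagonalized_by_sym Zp Zq dU).
Qed.

End Lyapunov.

Theorem theorem1p1 (R : realType) (N : nat) (hN : (1 <= N)%N) :
  (forall p : 'rV[R]_N * 'rV[R]_N, ZN R N p -> ZN R N (Omega p)) /\
  (forall p : 'rV[R]_N * 'rV[R]_N, ZN R N p -> Omega (Omega p) = p) /\
  set_bij (ZN R N) (ZN R N) (@Omega R N).
Proof.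
split; first exact: Omega_ZN.
split; first exact: OmegaK.
split=> [p|p q /set_mem Zp /set_mem Zq e|q Zq]; first exact: Omega_ZN.
- by rewrite -(OmegaK Zp) e OmegaK.
- by exists (Omega q); [exact: Omega_ZN|exact: OmegaK].
Qed.
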